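(* Let $N>1$ be an integer, $a\in\mathbb{R}$ with $|a|<1$, and $x_n=n/N$ for $n=0,\dots,N$. Let $g:[0,\infty)\to\mathbb{R}$ be bounded, with $g(x)=g(x-1)$ for all $x>1$, such that (1) $g$ is continuous on each of the intervals $[x_0,x_1],(x_1,x_2],\dots,(x_{N-1},x_N]$, and (2) the right limit $g(\tfrac nN+)$ exists for $n=1,\dots,N-1$. Let $f(x)=\sum_{k=0}^\infty a^kg(N^kx)$ for $x\ge0$; this is the solution of $f(x)-af(Nx)=g(x)$. Then $f$ interpolates the data $\{(x_n,y_n)\}_{n=0}^N$, where $$y_0=\frac{g(0)}{1-a},\qquad y_N=\frac{g(1)}{1-a},\qquad y_n=g(x_n)+\frac{a}{1-a}g(1)\ (n=1,\dots,N-1).$$ Moreover, the closure of the graph of $f$ restricted to $[0,1]$ is the unique attractor of the IFS $W=([0,1]\times\mathbb{R};w_1,\dots,w_N)$, where $w_n(x,y)=(L_n(x),ay+g_n(x))$, $L_n(x)=(x+n-1)/N$, and $$g_n(x)=\begin{cases} g(L_n(x)) & \text{if } 0<x<1,\\ g\!\left(\frac{n-1}{N}+\right) & \text{if } x=0,\\ g\!\left(\frac nN\right) & \text{if } x=1.\end{cases}$$ If in addition (3) $g(\tfrac nN+)-g(\tfrac nN)=\frac{a}{1-a}\big(g(1)-g(0)\big)$ for $n=1,\dots,N-1$, then $f$ is continuous on $[0,1]$ and the graph of $f$ restricted to $[0,1]$ is the unique attractor of this IFS.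
   Context: For $n=1$, $g(0+)$ means the right limit at $0$ (equal to $g(0)$ by (1)). The attractor of the IFS $W$ is the unique nonempty compact set $A\subseteq[0,1]\times\mathbb{R}$ with $A=\bigcup_{n=1}^N w_n(A)$. *)

(* Defs.v *)
From HB Require Import structures.
From mathcomp Require Import all_boot all_order all_algebra.
From mathcomp Require Import all_classical all_reals all_analysis.
Set Implicit Arguments. Unset Strict Implicit. Unset Printing Implicit Defensive.
Import Order.TTheory GRing.Theory Num.Theory.
Import numFieldNormedType.Exports.
Local Open Scope classical_set_scope.
Local Open Scope ring_scope.

Definition rlim {R : realType} (g : R -> R) (c : R) : R :=
  lim (g x @[x --> c^'+]).

Definition fsol {R : realType} (N : nat) (a : R) (g : R -> R) (x : R) : R :=
  limn (series (fun k : nat => a ^+ k * g (N%:R ^+ k * x))).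

Definition Lmap {R : realType} (N n : nat) (x : R) : R :=
  (x + n%:R - 1) / N%:R.

Definition gmap {R : realType} (N : nat) (g : R -> R) (n : nat) (x : R) : R :=
  if (0 < x) && (x < 1) then g (Lmap N n x)
  else if x == 0 then rlim g ((n%:R - 1) / N%:R)
  else g (n%:R / N%:R).

Definition wmap {R : realType} (N : nat) (a : R) (g : R -> R) (n : nat)
  (p : R * R) : R * R :=
  (Lmap N n p.1, a * p.2 + gmap N g n p.1).

Definition ifs_invariant {R : realType} (N : nat) (a : R) (g : R -> R)
  (A : set (R * R)) : Prop :=
  [/\ A !=set0, compact A, A `<=` [set p | 0 <= p.1 <= 1] &
      A = \bigcup_(n in [set n : nat | (1 <= n <= N)%N]) (wmap N a g n @` A)].

Definition is_unique_attractor {R : realType} (N : nat) (a : R) (g : R -> R)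
  (A : set (R * R)) : Prop :=
  ifs_invariant N a g A /\ (forall B, ifs_invariant N a g B -> B = A).

Definition graph01 {R : realType} (f : R -> R) : set (R * R) :=
  [set p | 0 <= p.1 <= 1 /\ p.2 = f p.1].

(* Main.v *)
Require Import Defs.
From HB Require Import structures.
From mathcomp Require Import all_boot all_order all_algebra.
From mathcomp Require Import all_classical all_reals all_analysis.
From mathcomp Require Import ring lra.
Import Order.TTheory GRing.Theory Num.Theory.
Import numFieldNormedType.Exports.
Local Open Scope classical_set_scope.
Local Open Scope ring_scope.

(* The functional equation f(x) = g(x) + a f(N x), combined with the periodicity
   of f on ]0, +oo[, says that the graph G of f over ]0, 1] satisfies
   G = w_1(G) U ... U w_N(G). The maps w_n are continuous on the strip
   [0, 1] x R, so the closure of G is a compact invariant set. The w_n need not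
   be contractions, but long compositions of them uniformly shrink bounded parts
   of the strip: a composition of k maps shrinks abscissae by N^-k, and then the
   uniform continuity of the g_n makes the ordinates contract by |a| up to a small
   error. This yields the uniqueness of the attractor, and also that
   (0, f 0), the fixed point of w_1, lies in the closure of G.
   Under the jump condition, f(L_n x) = a f(x) + g_n(x) also holds at x = 0; the
   vertical distance from a point of the attractor to the graph of f is then
   multiplied by |a| at each step, so it vanishes: the attractor is the graph,
   and a function with compact graph is continuous. *)

(** * Uniform continuity on compact sets *)

(** By near-covering compactness it is enough to treat [x'] close to a fixed [x] and [d] small; then
    [x'] and [y] lie in one ball where [h] is [e / 2]-close to [h x]. The filter form of the
    conclusion lets finitely many such moduli be intersected. *)
Lemma compact_uniformly_continuous (R : realType) (K : set R) (h : R -> R) :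
  compact K -> {within K, continuous h} ->
  forall e : R, 0 < e -> \forall d \near (0 : R)^'+,
    forall x y, K x -> K y -> `|x - y| < d -> `|h x - h y| < e.
Proof.
move=> /compact_near_coveringP cK /subspace_continuousP ch e e0.
pose P (d x : R) := K x -> forall y, K y -> `|x - y| < d -> `|h x - h y| < e.
have {cK} : \forall d \near (0 : R)^'+, K `<=` P d.
  apply: cK => x Kx.
  have /cvgrPdist_lt/(_ _ (divr_gt0 e0 (ltr0n _ 2))) := ch x Kx.
  rewrite near_withinE => /nbhs_ballP[r /= r0 hr].
  near=> x' d => Kx' y Ky x'y.
  have xx' : `|x - x'| < r / 2 by near: x'; apply: cvgr_dist_lt => //; lra.
  have dr : d < r / 2 by near: d; apply: nbhs_right_lt; lra.
  have := hr x'; have := hr y; rewrite /ball/= => hy hx'.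
  have {}hx' : `|h x - h x'| < e / 2 by apply: hx' => //=; rewrite (lt_trans xx')// ltr_pdivrMr// ltr_pMr// ltr1n.
  have {}hy : `|h x - h y| < e / 2.
    apply: hy => //=; rewrite (splitr r) (le_lt_trans (ler_distD x' _ _))//.
    by rewrite ltrD// (lt_trans x'y).
  by rewrite (splitr e) (le_lt_trans (ler_distD (h x) _ _))// ltrD// distrC.
by apply: filterS => d KP x y Kx; exact: KP.
Unshelve. all: by end_near. Qed.

(** * The series solution and its functional equation *)

Lemma fsol_normed_cvg (R : realType) (N : nat) (a M x : R) (g : R -> R) :
  `|a| < 1 -> (forall x, 0 <= x -> `|g x| <= M) -> 0 <= x ->
  cvgn [normed series (fun k : nat => a ^+ k * g (N%:R ^+ k * x))].
Proof.
move=> a1 gM x0; have M0 : 0 <= M := le_trans (normr_ge0 _) (gM 0 (lexx _)).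
apply: (@series_le_cvg _ _ (geometric M `|a|)) => [n|n|n|].
- exact: normr_ge0.
- by rewrite /= mulr_ge0 ?exprn_ge0.
- by rewrite /= normrM normrX mulrC ler_wpM2r ?exprn_ge0// gM ?mulr_ge0 ?exprn_ge0.
- by apply: is_cvg_geometric_series; rewrite normr_id.
Qed.

Lemma norm_fsol_le (R : realType) (N : nat) (a M x : R) (g : R -> R) :
  `|a| < 1 -> (forall x, 0 <= x -> `|g x| <= M) -> 0 <= x ->
  `|fsol N a g x| <= M / (1 - `|a|).
Proof.
move=> a1 gM x0; have cf := @fsol_normed_cvg _ N _ _ _ _ a1 gM x0.
have na1 : `| `|a| | < 1 by rewrite normr_id.
rewrite (le_trans (lim_series_norm cf))//.
rewrite -(cvg_lim _ (@cvg_geometric_series _ M _ na1))//.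
apply: lim_series_le => // [|n]; first exact: is_cvg_geometric_series.
by rewrite /= normrM normrX mulrC ler_wpM2r ?exprn_ge0// gM ?mulr_ge0 ?exprn_ge0.
Qed.

Lemma fsolE (R : realType) (N : nat) (a M x : R) (g : R -> R) :
  `|a| < 1 -> (forall x, 0 <= x -> `|g x| <= M) -> 0 <= x ->
  fsol N a g x = g x + a * fsol N a g (N%:R * x).
Proof.
move=> a1 gM x0.
have cf y : 0 <= y -> cvgn (series (fun k : nat => a ^+ k * g (N%:R ^+ k * y))).
  by move=> y0; exact: normed_cvg (@fsol_normed_cvg _ N _ _ _ _ a1 gM y0).
have cNx := cf (N%:R * x) (mulr_ge0 (ler0n _ _) x0).
apply/cvg_lim => //; rewrite -cvg_shiftS.
(* The first n + 1 terms at [x] sum to [g x] plus [a] times the sum of the first n terms at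
   [N%:R * x]. *)
under eq_fun => n.
  rewrite seriesEnat /= big_nat_recl// !expr0 !mul1r.
  under eq_bigr do rewrite exprS -mulrA exprSr -[_ * _ * x]mulrA.
  rewrite -mulr_sumr; over.
apply: cvgD; first exact: cvg_cst.
by apply: cvgMr; exact: cNx.
Qed.

(* False at [x = 0]: [g 0] need not equal [g 1]. *)
Lemma fsolDn (R : realType) (N : nat) (a x : R) (g : R -> R) (n : nat) :
  (0 < N)%N -> (forall x, 1 < x -> g x = g (x - 1)) -> 0 < x ->
  fsol N a g (x + n%:R) = fsol N a g x.
Proof.
move=> N0 gper x0.
have gD y m : 0 < y -> g (y + m%:R) = g y.
  move=> y0; elim: m => [|m IH]; first by rewrite addr0.
  by rewrite gper -natr1 ?addrA ?addrK// -addrA natr1 ltr_pwDl// ler1n.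
congr (limn (series _)); apply/funext => k.
by rewrite mulrDr -natrX -natrM gD// mulr_gt0// ltr0n expn_gt0 N0.
Qed.

(** * Continuity of the maps g_n and w_n *)

Lemma within_itv_oc_cvg (R : realType) (c d x : R) (g : R -> R) :
  {within `]c, d], continuous g} -> c < x <= d ->
  g y @[y --> x^'-] --> g x /\ (x < d -> g y @[y --> x] --> g x).
Proof.
move=> gc /andP[cx xd].
(* The interval does not contain [c]; closed intervals starting at the midpoint [m] stay inside
   it. *)
pose m := (c + x) / 2.
have cm : c < m by rewrite /m; lra.
have mx : m < x by rewrite /m; lra.
split=> [|{}xd].
  have [] // := (continuous_within_itvP g mx).1 _.
  apply: continuous_subspaceW gc => y /=; rewrite !in_itv/= => /andP[my yx].
  by rewrite (lt_le_trans cm my) (le_trans yx xd).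
have md := lt_trans mx xd.
apply: (@within_continuous_continuous _ _ _ m d) => //; last by rewrite in_itv/= mx.
apply: continuous_subspaceW gc => y /=; rewrite !in_itv/= => /andP[my ->].
by rewrite (lt_le_trans cm my).
Qed.

Lemma Lmap_gt (R : realType) (N n : nat) (x : R) : (0 < N)%N -> 0 < x ->
  (n%:R - 1) / N%:R < Lmap N n x.
Proof. by move=> N0 x0; rewrite /Lmap ltr_pM2r ?invr_gt0 ?ltr0n//; lra. Qed.

Lemma Lmap_lt (R : realType) (N n : nat) (x : R) : (0 < N)%N -> x < 1 ->
  Lmap N n x < n%:R / N%:R.
Proof. by move=> N0 x0; rewrite /Lmap ltr_pM2r ?invr_gt0 ?ltr0n//; lra. Qed.

Lemma Lmap_le (R : realType) (N n : nat) (x : R) : (0 < N)%N -> x <= 1 ->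
  Lmap N n x <= n%:R / N%:R.
Proof. by move=> N0 x0; rewrite /Lmap ler_pM2r ?invr_gt0 ?ltr0n//; lra. Qed.

Lemma continuous_Lmap (R : realType) (N n : nat) : continuous (@Lmap R N n).
Proof.
move=> x; rewrite /Lmap; apply: cvgMl; apply: cvgB; last exact: cvg_cst.
by apply: cvgD; [exact: cvg_id|exact: cvg_cst].
Qed.

(** L_n is increasing, so it stays to the right of the node. The one-sided target filter is what
    composes with [g], which may jump at a node. *)
Lemma Lmap_at_right0 (R : realType) (N n : nat) : (0 < N)%N ->
  @Lmap R N n y @[y --> 0^'+] --> ((n%:R - 1) / N%:R)^'+.
Proof.
move=> N0 U; rewrite /at_right/= !nbhs_simpl/= /within/= => cU.
have : \forall y \near (0 : R), (n%:R - 1) / N%:R < Lmap N n y -> U (Lmap N n y).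
  have L0 : Lmap N n 0 = (n%:R - 1) / N%:R :> R by rewrite /Lmap add0r.
  by have := @continuous_Lmap R N n 0; rewrite /continuous_at L0 => /(_ _ cU).
by apply: filterS => y + y0; apply; exact: Lmap_gt.
Qed.

Lemma Lmap_at_left1 (R : realType) (N n : nat) : (0 < N)%N ->
  @Lmap R N n y @[y --> 1^'-] --> (n%:R / N%:R)^'-.
Proof.
move=> N0 U; rewrite /at_left/= !nbhs_simpl/= /within/= => cU.
have : \forall y \near (1 : R), Lmap N n y < n%:R / N%:R -> U (Lmap N n y).
  have L1 : Lmap N n 1 = n%:R / N%:R :> R by rewrite /Lmap addrAC subrr add0r.
  by have := @continuous_Lmap R N n 1; rewrite /continuous_at L1 => /(_ _ cU).
by apply: filterS => y + y0; apply; exact: Lmap_lt.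
Qed.

(** The endpoint values of [gmap] are the one-sided limits of the composite of [g] with L_n, so they
    extend it continuously from the open interval. *)
Lemma continuous_gmap (R : realType) (N n : nat) (g : R -> R) : (0 < N)%N ->
  {within `](n%:R - 1) / N%:R, n%:R / N%:R], continuous g} ->
  cvg (g x @[x --> ((n%:R - 1) / N%:R)^'+]) ->
  {within `[0, 1], continuous (gmap N g n)}.
Proof.
move=> N0 gc gr.
(* A filter concentrated on []0, 1[] sees only the first branch of [gmap]. *)
have gmapE (F : set_system R) (l : R) : Filter F ->
    (\forall y \near F, 0 < y) -> (\forall y \near F, y < 1) ->
    g (Lmap N n y) @[y --> F] --> l -> gmap N g n y @[y --> F] --> l.
  move=> FF F0 F1; apply: cvg_trans; apply: near_eq_cvg; near=> y.
  rewrite /gmap; have -> // : 0 < y < 1.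
  by apply/andP; split; near: y.
apply/continuous_within_itvP => //; split=> [x|| ].
- rewrite in_itv/= => /andP[x0 x1].
  have E : gmap N g n x = g (Lmap N n x) by rewrite /gmap x0 x1.
  apply: gmapE; [exact: lt_nbhsr|exact: lt_nbhsl|rewrite E].
  apply: (cvg_comp (Lmap N n) g (continuous_Lmap R N n x)).
  have [|_ +] := @within_itv_oc_cvg _ _ _ (Lmap N n x) _ gc.
    by rewrite Lmap_gt// Lmap_le// ltW.
  by apply; exact: Lmap_lt.
- have -> : gmap N g n 0 = rlim g ((n%:R - 1) / N%:R) by rewrite /gmap ltxx eqxx.
  apply: gmapE; [exact: nbhs_right_gt|exact: nbhs_right_lt|].
  exact: (cvg_comp (Lmap N n) g (Lmap_at_right0 _ _ _ N0) gr).
- have -> : gmap N g n 1 = g (n%:R / N%:R) by rewrite /gmap ltxx andbF oner_eq0.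
  apply: gmapE; [exact: nbhs_left_gt|exact: nbhs_left_lt|].
  apply: (cvg_comp (Lmap N n) g (Lmap_at_left1 _ _ _ N0)) => //.
  have [|+ _] := @within_itv_oc_cvg _ _ _ (n%:R / N%:R) _ gc; last exact.
  by rewrite lexx ltr_pM2r ?invr_gt0 ?ltr0n// ltrBlDr ltrDl ltr01.
Unshelve. all: by end_near. Qed.

Definition strip (R : realType) : set (R * R) := [set p | 0 <= p.1 <= 1].

Lemma continuous_wmap (R : realType) (N n : nat) (a : R) (g : R -> R) :
  {within `[0, 1], continuous (gmap N g n)} ->
  {within strip R, continuous (wmap N a g n)}.
Proof.
move=> /subspace_continuousP gc; apply/subspace_continuousP => -[x y] xS.
apply: (@cvg_pair _ _ _ _ (nbhs _) (nbhs _)) => /=.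
  apply: cvg_within_filter.
  apply: (@cvg_comp _ _ _ fst (Lmap N n) _ (nbhs x)); first exact: cvg_fst.
  exact: (@continuous_Lmap R N n x).
apply: cvgD; first by apply: cvgMr; apply: (@cvg_within_filter _ _ snd _ _ (nbhs y)); exact: cvg_snd.
have xI : `[0, 1]%classic x by rewrite /= in_itv.
apply: (@cvg_comp _ _ _ fst (gmap N g n) _ _ _ _ (gc x xI)) => U.
rewrite /= !nbhs_simpl /within/= => xU.
have : \forall p \near (x, y), p.1 \in `[0, 1] -> U p.1.
  exact: (@cvg_fst _ _ (nbhs x) (nbhs y) (nbhs_filter y) _ xU).
by apply: filterS => -[x' y'] /= + x'S; apply; rewrite in_itv.
Qed.

(** * Approximation along long compositions of the maps *)

Lemma closure_prodP (R : realType) (A : set (R * R)) (p : R * R) :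
  (forall e : R, 0 < e -> exists2 q, A q & `|p.1 - q.1| < e /\ `|p.2 - q.2| < e) ->
  closure A p.
Proof.
move=> Ap U /nbhs_ballP[e /= e0 eU].
by have [q Aq [q1 q2]] := Ap e e0; exists q; split=> //; exact: eU.
Qed.

(* A point of [B] is the image of a point of [B] under a long composition of the
   maps; the same composition sends any point of [A] to a nearby point of [A]. *)
Lemma sub_closure_ifs (R : realType) (N : nat) (a C : R) (g : R -> R)
    (A B : set (R * R)) :
  (1 < N)%N -> `|a| < 1 ->
  (forall n, (1 <= n <= N)%N -> {within `[0, 1], continuous (gmap N g n)}) ->
  A !=set0 -> A `<=` strip R -> B `<=` strip R ->
  (forall p, A p -> `|p.2| <= C) -> (forall p, B p -> `|p.2| <= C) ->
  (forall n p, (1 <= n <= N)%N -> A p -> A (wmap N a g n p)) ->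
  B `<=` \bigcup_(n in [set n | (1 <= n <= N)%N]) (wmap N a g n @` B) ->
  B `<=` closure A.
Proof.
move=> N1 a1 gc [q0 Aq0] AS BS AC BC Aw Bw.
have C0 : 0 <= C := le_trans (normr_ge0 _) (AC _ Aq0).
have N0 : (0 : R) < N%:R by rewrite ltr0n ltnW.
(* The two errors are tracked separately: the horizontal one always shrinks by 1/N, while the
   vertical one contracts, up to a small term, only once the horizontal one is small. *)
pose S (d e : R) :=
  forall b, B b -> exists2 q, A q & `|b.1 - q.1| <= d /\ `|b.2 - q.2| <= e.
have Lmap_dist n (x y d : R) : `|x - y| <= d ->
    `|Lmap N n x - Lmap N n y| <= N%:R^-1 * d.
  move=> xyd; have -> : Lmap N n x - Lmap N n y = N%:R^-1 * (x - y).
    by rewrite /Lmap; ring.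
  by rewrite normrM ger0_norm ?invr_ge0 ?ler0n// ler_pM2l// invr_gt0.
have S2C k : S (N%:R^-1 ^+ k) (C + C).
  elim: k => [|k IH] b Bb.
    exists q0 => //; split; last first.
      by rewrite (le_trans (ler_normB _ _))// lerD//; [exact: BC|exact: AC].
    move: (AS _ Aq0) (BS _ Bb) => /andP[? ?] /andP[? ?].
    by rewrite expr0 ler_norml; apply/andP; split; lra.
  have [n nN [b' Bb' bE]] := Bw _ Bb.
  have [q Aq [q1 _]] := IH _ Bb'.
  have Awq := Aw n q nN Aq.
  exists (wmap N a g n q) => //; split; last first.
    by rewrite (le_trans (ler_normB _ _))// lerD//; [exact: BC|exact: AC].
  by rewrite -bE exprS; exact: Lmap_dist.
have step eta : 0 < eta -> exists2 d0, 0 < d0 & forall d e, d < d0 ->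
    S d e -> S (N%:R^-1 * d) (`|a| * e + eta).
  move=> eta0.
  (* A finite index type allows one modulus [d0] to serve all the maps; the index 0 holds
     vacuously. *)
  pose P d (i : 'I_N.+1) := (1 <= i)%N -> forall x y, `[0, 1]%classic x ->
    `[0, 1]%classic y -> `|x - y| < d -> `|gmap N g i x - gmap N g i y| < eta.
  have HP : \forall d \near (0 : R)^'+, forall i, P d i.
    apply: filter_forall => i; case: (ltnP 0 i) => i0; last first.
      by apply: nearW => d; rewrite /P leqNgt ltnS i0.
    have iN : (1 <= i <= N)%N by rewrite i0 -ltnS ltn_ord.
    have := compact_uniformly_continuous _ _ _ (@segment_compact _ 0 1) (gc i iN) _ eta0.
    by apply: filterS => d Hd _; exact: Hd.
  near (0 : R)^'+ => d0.
  have H n : (1 <= n <= N)%N -> forall x y,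
     `[0, 1]%classic x -> `[0, 1]%classic y -> `|x - y| < d0 ->
        `|gmap N g n x - gmap N g n y| < eta.
    move=> /andP[n1 nN]; have Pd0 : forall i, P d0 i by near: d0; exact: HP.
    exact: (Pd0 (Ordinal (nN : (n < N.+1)%N))).
  exists d0; first by near: d0; exact: nbhs_right_gt.
  move=> d e dd0 Sde b /Bw[n nN [b' Bb' <-]].
  have [q Aq [q1 q2]] := Sde _ Bb'.
  exists (wmap N a g n q); [exact: Aw|split; first exact: Lmap_dist].
  rewrite /= opprD addrACA -mulrBr (le_trans (ler_normD _ _))// lerD//.
    by rewrite normrM ler_wpM2l.
  rewrite ltW// H//= ?in_itv/=; [exact: BS|exact: AS|exact: le_lt_trans dd0].
have N1' : `|N%:R^-1 : R| < 1.
  by rewrite ger0_norm ?invr_ge0 ?ler0n// invf_lt1// ltr1n.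
move=> b Bb; apply: closure_prodP => e e0.
(* With this [eta], [e / 2] is the fixed point of t |-> |a| t + eta. *)
have [|d0 d00 {}step] := step ((1 - `|a|) * (e / 2)).
  by rewrite mulr_gt0 ?divr_gt0// subr_gt0.
(* The first [k] maps only reduce the horizontal error, with the crude vertical bound [C + C]; the
   next [j] maps contract the vertical one. *)
have [k [kd0 ke]] : exists k, N%:R^-1 ^+ k < d0 /\ (N%:R^-1 : R) ^+ k < e.
  near \oo => k; exists k.
  suff : `|0 - N%:R^-1 ^+ k| < Num.min d0 e.
    by rewrite sub0r normrN ger0_norm ?exprn_ge0 ?invr_ge0// lt_min => /andP[].
  near: k; apply: (@cvgr_dist_lt _ _ _ _ _ _ _ (@cvg_expr R _ N1')).
  by rewrite lt_min d00.
have Skj j : S (N%:R^-1 ^+ (j + k)) (`|a| ^+ j * (C + C) + e / 2).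
  elim: j => [|j IH] b' Bb'.
    have [q Aq [q1 q2]] := S2C k b' Bb'; exists q => //; split => //.
    by rewrite expr0 mul1r (le_trans q2)// lerDl ltW// divr_gt0.
  have jkd0 : N%:R^-1 ^+ (j + k) < d0.
    rewrite (le_lt_trans _ kd0)// exprD ler_piMl ?exprn_ge0 ?invr_ge0//.
    by rewrite exprn_ile1 ?invr_ge0// ltW// invf_lt1// ltr1n.
  have [q Aq [q1 q2]] := step _ _ jkd0 IH b' Bb'.
  exists q => //; split; first by rewrite addSn exprS.
  by rewrite (le_trans q2)// exprS le_eqVlt; apply/orP; left; apply/eqP; ring.
have [j je] : exists j, `|a| ^+ j * (C + C) < e / 2.
  have na1 : `| `|a| | < 1 by rewrite normr_id.
  near \oo => j; exists j.
  suff : `|0 - geometric (C + C) `|a| j| < e / 2.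
    by rewrite sub0r normrN ger0_norm /= ?mulr_ge0 ?exprn_ge0 ?addr_ge0// mulrC.
  near: j; apply: (@cvgr_dist_lt _ _ _ _ _ _ _ (@cvg_geometric R _ _ na1)).
  by rewrite divr_gt0.
have [q Aq [q1 q2]] := Skj j b Bb; exists q => //; split.
  rewrite (le_lt_trans q1)// (le_lt_trans _ ke)// exprD ler_piMl ?exprn_ge0 ?invr_ge0//.
  by rewrite exprn_ile1 ?invr_ge0// ltW// invf_lt1// ltr1n.
by rewrite (le_lt_trans q2)// [ltRHS]splitr ltrD2r.
Unshelve. all: by end_near. Qed.

(** * Invariance of closures and uniqueness of the attractor *)

Lemma compact_snd_bounded (R : realType) (A : set (R * R)) : compact A ->
  exists C : R, forall p, A p -> `|p.2| <= C.
Proof.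
move=> cA; have : compact (snd @` A).
  by apply: continuous_compact => //; apply: continuous_subspaceT => p; exact: cvg_snd.
move=> /(@compact_bounded R R)/pinfty_ex_gt0[C _ HC].
by exists C => p Ap; apply: HC; exists p.
Qed.

Lemma compact_closedR2 (R : realType) (A : set (R * R)) : compact A -> closed A.
Proof. by apply: compact_closed; exact: norm_hausdorff. Qed.

Lemma strip_bounded_compact (R : realType) (A : set (R * R)) (C : R) :
  A `<=` strip R -> (forall p, A p -> `|p.2| <= C) ->
  [/\ compact (closure A), closure A `<=` strip R &
      forall p, closure A p -> `|p.2| <= C].
Proof.
move=> AS AC; pose K : set (R * R) := `[0, 1] `*` `[- C, C].
have cK : compact K by apply: compact_setX; exact: segment_compact.
have clK : closure A `<=` K.
  rewrite [K](closure_id _).1; last exact: compact_closedR2.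
  apply: closure_subset => p Ap; split; rewrite /= in_itv/=; first exact: AS.
  by rewrite -ler_norml; exact: AC.
split.
- by apply: (@subclosed_compact _ _ K) => //; exact: closed_closure.
- by move=> p /clK[/=]; rewrite in_itv.
- by move=> p /clK[/= _]; rewrite in_itv/= -ler_norml.
Qed.

(** The finite union of the compact images of [closure A] is closed and contains [A], hence its
    closure. Conversely, continuity on the strip sends limit points of [A] to limit points of
    [A]. *)
Lemma closure_ifs_invariant (R : realType) (N : nat) (a C : R) (g : R -> R)
    (A : set (R * R)) :
  (forall n, (1 <= n <= N)%N -> {within `[0, 1], continuous (gmap N g n)}) ->
  A !=set0 -> A `<=` strip R -> (forall p, A p -> `|p.2| <= C) ->
  A = \bigcup_(n in [set n | (1 <= n <= N)%N]) (wmap N a g n @` A) ->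
  ifs_invariant N a g (closure A).
Proof.
move=> gc [p0 Ap0] AS AC AE.
have [clc clS clC] := @strip_bounded_compact _ _ _ AS AC.
split=> //; first by exists p0; exact: subset_closure.
apply/seteqP; split.
- set K := \bigcup_(n in _) _.
  have clK : closed K.
    apply: closed_bigcup => [|n nN].
      by apply: (@sub_finite_set _ _ `I_N.+1) => // n /= /andP[].
    apply: compact_closedR2; apply: continuous_compact clc.
    by apply: continuous_subspaceW clS _; apply: continuous_wmap; exact: gc.
  rewrite [K](closure_id _).1//; apply: closure_subset => p.
  rewrite {1}AE => -[n nN [q Aq <-]]; exists n => //; exists q => //.
  exact: subset_closure.
- move=> _ [n nN [p clp <-]] U Uwp.
  have /subspace_continuousP/(_ p (clS _ clp) U Uwp) := @continuous_wmap _ _ _ a _ (gc n nN).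
  move=> /clp[q [Aq SUq]]; exists (wmap N a g n q); split; last exact/SUq/AS.
  by rewrite AE; exists n => //; exists q.
Qed.

Lemma ifs_invariant_unique (R : realType) (N : nat) (a : R) (g : R -> R)
    (A B : set (R * R)) :
  (1 < N)%N -> `|a| < 1 ->
  (forall n, (1 <= n <= N)%N -> {within `[0, 1], continuous (gmap N g n)}) ->
  ifs_invariant N a g A -> ifs_invariant N a g B -> B = A.
Proof.
move=> N1 a1 gc.
suff sub A' B' : ifs_invariant N a g A' -> ifs_invariant N a g B' -> B' `<=` A'.
  by move=> iA iB; apply/seteqP; split; exact: sub.
move=> [A0 cA AS AE] [_ cB BS BE].
have [CA HCA] := compact_snd_bounded _ _ cA; have [CB HCB] := compact_snd_bounded _ _ cB.
rewrite [A'](closure_id _).1; last exact: compact_closedR2.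
apply: (@sub_closure_ifs _ N a (Num.max CA CB) g) => //.
- by move=> p Ap; rewrite le_max HCA.
- by move=> p Bp; rewrite le_max HCB// orbT.
- by move=> n p nN Ap; rewrite AE; exists n => //; exists p.
- by rewrite -BE.
Qed.

(** * Compact graphs and invariant sets contained in a graph *)

(** The preimage of a closed set [C] is the first projection of the compact set of graph points with
    ordinate in [C]. *)
Lemma compact_graph01_continuous (R : realType) (f : R -> R) :
  compact (graph01 f) -> {within `[0, 1], continuous f}.
Proof.
move=> cf; apply/continuous_closedP => C cC; apply/closed_subspaceP.
exists (fst @` (graph01 f `&` snd @^-1` C)).
  apply: compact_closed; first exact: norm_hausdorff.
  apply: continuous_compact.
    by apply: continuous_subspaceT => p; exact: cvg_fst.
  apply: (@subclosed_compact _ _ (graph01 f)) => //.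
  apply: closedI; first exact: compact_closedR2.
  by apply: closed_comp => // p _; exact: cvg_snd.
apply/seteqP; split=> [x [[[x' y] [[/= x01 ->] Cfx] <-] ?]|x [Cfx]] //.
rewrite /= in_itv/= => x01; split=> //.
by exists (x, f x).
Qed.

Lemma ifs_sub_graph01 (R : realType) (N : nat) (a C : R) (g f : R -> R)
    (A : set (R * R)) :
  `|a| < 1 -> A `<=` strip R -> (forall p, A p -> `|p.2| <= C) ->
  (forall x, 0 <= x <= 1 -> `|f x| <= C) ->
  (forall n x, (1 <= n <= N)%N -> 0 <= x <= 1 ->
     f (Lmap N n x) = a * f x + gmap N g n x) ->
  A `<=` \bigcup_(n in [set n | (1 <= n <= N)%N]) (wmap N a g n @` A) ->
  A `<=` graph01 f.
Proof.
move=> a1 AS AC fC fL Aw.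
(* Passing to a preimage under w_n cancels the [gmap] terms and leaves a factor |a|. *)
have dist k p : A p -> `|p.2 - f p.1| <= `|a| ^+ k * (C + C).
  elim: k p => [|k IH] p Ap.
    by rewrite expr0 mul1r (le_trans (ler_normB _ _))// lerD//; [exact: AC|exact/fC/AS].
  have [n nN [q Aq <-]] := Aw _ Ap.
  rewrite /= fL//; last exact: AS.
  by rewrite opprD addrACA subrr addr0 -mulrBr normrM exprS -mulrA ler_wpM2l// IH.
move=> p Ap; split; first exact: AS.
apply/eqP; rewrite -subr_eq0 -normr_le0.
have na1 : `| `|a| | < 1 by rewrite normr_id.
have c0 := @cvg_geometric R (C + C) _ na1.
rewrite -(cvg_lim _ c0)//; apply: limr_ge; first by apply/cvg_ex; exists 0.
by apply: nearW => k /=; rewrite mulrC; exact: dist.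
Qed.

(** * The N cells of the unit interval *)

Lemma Lmap_onto (R : realType) (N : nat) (t : R) : (0 < N)%N -> 0 < t <= 1 ->
  exists2 n, (1 <= n <= N)%N & exists2 x, 0 < x <= 1 & t = Lmap N n x.
Proof.
move=> N0 /andP[t0 t1]; have N0' : (0 : R) < N%:R by rewrite ltr0n.
(* The cell index is the least such m; minimality makes the preimage t N - (m - 1) positive. *)
have exn : exists m, t * N%:R <= m%:R by exists N; rewrite ler_piMl// ltW.
case: (ex_minnP exn) => -[|n] tn nmin.
  by move: tn; rewrite leNgt mulr_gt0.
exists n.+1; first by rewrite /= nmin// ler_piMl// ltW.
exists (t * N%:R - n%:R); last first.
  by rewrite /Lmap -[n.+1%:R]natr1 addrA subrK addrK mulfK// gt_eqF.
rewrite subr_gt0 lerBlDl natr1 tn andbT ltNge.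
by apply/negP => /nmin; rewrite ltnn.
Qed.

Lemma Lmap01 (R : realType) (N n : nat) (x : R) : (1 <= n <= N)%N ->
  0 <= x <= 1 -> 0 <= Lmap N n x <= 1.
Proof.
move=> /andP[n1 nN] /andP[x0 x1]; have N0 := leq_trans n1 nN.
rewrite (le_trans (Lmap_le _ _ _ _ N0 x1)) ?ler_pdivrMr ?ltr0n ?mul1r ?ler_nat//.
by rewrite divr_ge0// -addrA addr_ge0// subr_ge0 ler1n.
Qed.

(** * Interpolation, the attractor, and the continuous case *)

Theorem theorem4p2 (R : realType) (N : nat) (a : R) (g : R -> R) :
  (1 < N)%N -> `|a| < 1 ->
  (exists M : R, forall x, 0 <= x -> `|g x| <= M) ->
  (forall x, 1 < x -> g x = g (x - 1)) ->
  {within `[0, N%:R^-1], continuous g} ->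
  (forall n : nat, (1 <= n < N)%N ->
     {within `]n%:R / N%:R, n.+1%:R / N%:R], continuous g}) ->
  (forall n : nat, (1 <= n < N)%N -> cvg (g x @[x --> (n%:R / N%:R)^'+])) ->
  [/\ fsol N a g 0 = g 0 / (1 - a),
      fsol N a g 1 = g 1 / (1 - a),
      (forall n : nat, (1 <= n < N)%N ->
         fsol N a g (n%:R / N%:R) = g (n%:R / N%:R) + a / (1 - a) * g 1),
      is_unique_attractor N a g (closure (graph01 (fsol N a g))) &
      ((forall n : nat, (1 <= n < N)%N ->
          rlim g (n%:R / N%:R) - g (n%:R / N%:R) = a / (1 - a) * (g 1 - g 0)) ->
       {within `[0, 1], continuous (fsol N a g)} /\
       is_unique_attractor N a g (graph01 (fsol N a g)))].
Proof.
move=> N1 a1 [M gM] gper g0c gc gr.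
have N0 : (0 < N)%N := ltnW N1.
have N0' : (0 : R) < N%:R by rewrite ltr0n.
have a1' : 1 - a != 0 by rewrite subr_eq0 eq_sym lt_eqF// (le_lt_trans (ler_norm a)).
set f := fsol N a g.
have fE x : 0 <= x -> f x = g x + a * f (N%:R * x) by exact: (@fsolE _ _ _ M).
have fD x n : 0 < x -> f (x + n%:R) = f x by exact: fsolDn.
have fn n : (1 <= n)%N -> f n%:R = f 1.
  by case: n => // n _; rewrite -natr1 addrC fD.
have solve y c : y = c + a * y -> y = c / (1 - a).
  by move=> yc; apply/(canRL (mulfK a1')); rewrite mulrBr mulr1 {1}yc; ring.
have f0E : f 0 = g 0 + a * f 0 by rewrite {1}fE// mulr0.
have f0 : f 0 = g 0 / (1 - a) := solve _ _ f0E.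
have f1 : f 1 = g 1 / (1 - a) by apply: solve; rewrite {1}fE// mulr1 fn.
have fnN n : (1 <= n < N)%N -> f (n%:R / N%:R) = g (n%:R / N%:R) + a / (1 - a) * g 1.
  move=> /andP[n1 nN]; rewrite fE ?divr_ge0// [N%:R * _]mulrC divfK ?gt_eqF// fn// f1.
  by rewrite mulrA mulrAC.
have [_ g0r _] : [/\ {in `]0, N%:R^-1[, continuous g},
    g x @[x --> 0^'+] --> g 0 & g x @[x --> N%:R^-1^'-] --> g N%:R^-1].
  by apply/continuous_within_itvP => //; rewrite invr_gt0.
have rlim0 : rlim g 0 = g 0 by exact: cvg_lim.
have gmapc n : (1 <= n <= N)%N -> {within `[0, 1], continuous (gmap N g n)}.
  case: n => [//|[|n]] nN; apply: continuous_gmap => //.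
  - rewrite subrr mul0r mul1r; apply: continuous_subspaceW g0c => x /=.
    by rewrite !in_itv/= => /andP[/ltW -> ->].
  - by rewrite subrr mul0r; apply/cvg_ex; exists (g 0).
  - by rewrite -[n.+2%:R in X in `]X, _]]natr1 addrK; exact: gc.
  - by rewrite -natr1 addrK; exact: gr.
(* The point [x = 0] is left out: reducing N L_n(x) = x + (n - 1) to [x] uses periodicity, which
   holds for positive arguments. *)
have fL n x : (1 <= n <= N)%N -> 0 < x <= 1 ->
    f (Lmap N n x) = a * f x + gmap N g n x.
  move=> nN xI; have /andP[x0 x1] := xI.
  have /andP[n1 _] := nN.
  have -> : gmap N g n x = g (Lmap N n x).
    rewrite /gmap x0/=; move: x1; rewrite le_eqVlt => /predU1P[->|->//].
    by rewrite ltxx oner_eq0 /Lmap addrAC subrr add0r.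
  have xI' : 0 <= x <= 1 by rewrite ltW.
  rewrite fE; last by have /andP[] := Lmap01 _ _ _ _ nN xI'.
  rewrite addrC; congr (a * _ + _).
  rewrite /Lmap [N%:R * _]mulrC divfK ?gt_eqF// -(prednK n1) -natr1 addrA addrK.
  exact: fD.
pose C := M / (1 - `|a|).
have fC x : 0 <= x <= 1 -> `|f x| <= C by move=> /andP[x0 _]; exact: norm_fsol_le.
have GS : graph01 f `<=` strip R by move=> p [].
have GC p : graph01 f p -> `|p.2| <= C by move=> [pI ->]; exact: fC.
(* The point (0, f 0) is removed because, without the jump condition, its image under w_n with n > 1
   may miss the graph. *)
pose G : set (R * R) := [set p | 0 < p.1 <= 1 /\ p.2 = f p.1].
have GG : G `<=` graph01 f by move=> p [/andP[p0 p1] pf]; split=> //; rewrite ltW.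
have GE : G = \bigcup_(n in [set n | (1 <= n <= N)%N]) (wmap N a g n @` G).
  apply/seteqP; split=> [[x y] [/= xI ->]|_ [n nN [[x y] [/= xI ->] <-]]].
    have [n nN [t tI ->]] := Lmap_onto _ _ _ N0 xI.
    by exists n => //; exists (t, f t) => //; rewrite /wmap/= fL.
  split; last by rewrite /= fL.
  have /andP[x0 x1] := xI; have xI' : 0 <= x <= 1 by rewrite ltW.
  have /andP[_ ->] := Lmap01 _ _ _ _ nN xI'.
  rewrite andbT (le_lt_trans _ (Lmap_gt _ _ _ _ N0 x0))// divr_ge0// subr_ge0 ler1n.
  by case/andP: nN.
have Gn0 : G !=set0 by exists (1, f 1); split=> //=; rewrite ltr01 lexx.
have [clcG clSG clCG] := @strip_bounded_compact _ _ _ (subset_trans GG GS) (fun p Gp => GC p (GG p Gp)).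
have clGinv : ifs_invariant N a g (closure G).
  apply: (@closure_ifs_invariant _ _ _ C) => //.
  - by move=> p /GG/GS.
  - by move=> p /GG/GC.
have w10 : wmap N a g 1 (0, f 0) = (0, f 0).
  by rewrite /wmap /Lmap /gmap/= ltxx eqxx add0r subrr mul0r rlim0 addrC -f0E.
(* The full graph need only have preimages in itself: (0, f 0) is fixed by w_1, and every other
   point has a preimage in [G]. *)
have graphG : graph01 f `<=` closure G.
  apply: (@sub_closure_ifs _ N a C g) => //.
  - by move=> p /GG/GS.
  - by move=> p /GG/GC.
  - by move=> n p nN Gp; rewrite GE; exists n => //; exists p.
  - move=> [x y] [/= /andP[x0 x1] ->]; move: x0; rewrite le_eqVlt => /predU1P[<-|x0].
      exists 1%N; first by rewrite /= N0.
      by exists (0, f 0) => //; split; rewrite /= ?lexx ?ler01.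
    have : G (x, f x) by split; rewrite //= x0.
    by rewrite GE => -[n nN [p /GG Gp pE]]; exists n => //; exists p.
have clE : closure (graph01 f) = closure G.
  apply/seteqP; split; last exact: closure_subset.
  by rewrite [X in _ `<=` X](closure_id _).1; [exact: closure_subset|exact: closed_closure].
have attr : is_unique_attractor N a g (closure (graph01 f)).
  rewrite clE; split=> // B; exact: ifs_invariant_unique.
split=> // jump.
have fL0 n x : (1 <= n <= N)%N -> 0 <= x <= 1 ->
    f (Lmap N n x) = a * f x + gmap N g n x.
  move=> nN /andP[]; rewrite le_eqVlt => /predU1P[<- _|x0 x1]; last first.
    by apply: fL; rewrite ?x0.
  have -> : gmap N g n 0 = rlim g ((n%:R - 1) / N%:R) by rewrite /gmap ltxx eqxx.
  rewrite /Lmap add0r; case: n nN => [//|[|n]] nN.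
    by rewrite subrr mul0r rlim0 {1}f0E addrC.
  (* Here L_{n+2}(0) is the interior node (n + 1)/N; after substituting the jump condition for the
     right limit, the [g 0] terms cancel. *)
  rewrite -[n.+2%:R]natr1 addrK fnN// f0.
  have /eqP := jump n.+1 nN; rewrite subr_eq => /eqP ->.
  by field.
have clGE : closure G = graph01 f.
  apply/seteqP; split=> //; apply: (@ifs_sub_graph01 _ N a C g) => //.
  by case: clGinv => _ _ _ {1}->.
split; last by rewrite -clGE -clE.
by apply: compact_graph01_continuous; rewrite -clGE.
Qed.
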